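(* Let $X$ be a Banach space with the Daugavet property and let $T\in\mathcal{L}(X,X)$. Suppose that for every $\varepsilon>0$ there exists an element $Tx\in\mathrm{SCD}\bigl(T(B_X)\bigr)$ such that $\|Tx\|>\|T\|-\varepsilon$. Then $T$ satisfies the Daugavet equation $\|\mathrm{Id}+T\|=1+\|T\|$.
   Context: Banach spaces are over $\mathbb{K}=\mathbb{R}$ or $\mathbb{C}$; $B_X$ and $X^*$ denote the closed unit ball and the topological dual of $X$, $\mathcal{L}(X,X)$ is the space of bounded linear operators from $X$ to $X$ with the operator norm, and $\mathrm{Id}$ is the identity operator on $X$. A slice of a non-empty bounded set $A\subseteq X$ is a non-empty intersection of $A$ with an open half-space; it can always be written as $S(A,x^*,\alpha)=\{x\in A:\operatorname{Re}x^*(x)>\sup_{b\in A}\operatorname{Re}x^*(b)-\alpha\}$ for suitable $x^*\in X^*$ and $\alpha>0$. Let $A\subseteq X$ be bounded and convex and let $a\in A$. A countable collection $\{V_n:n\in\mathbb{N}\}$ of non-empty subsets of $A$ is determining for $a$ if $a\in\overline{\mathrm{conv}}(B)$ (the closed convex hull of $B$) whenever $B\subseteq A$ intersects all the sets $V_n$. The point $a$ is an SCD point (slicely countably determined point) of $A$ if there is a sequence of slices of $A$ that is determining for $a$; $\mathrm{SCD}(A)$ is the set of all SCD points of $A$. A Banach space $X$ has the Daugavet property if $\|\mathrm{Id}+R\|=1+\|R\|$ for every rank-one bounded linear operator $R$ on $X$. *)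

(* Defs.v *)
From HB Require Import structures.
From mathcomp Require Import all_boot all_order all_algebra.
From mathcomp Require Import all_classical all_reals.
From mathcomp Require Import topology normedtype convex.
From mathcomp.real_closed Require Import complex.

Set Implicit Arguments.
Unset Strict Implicit.
Unset Printing Implicit Defensive.

Import Order.TTheory GRing.Theory Num.Theory.
Import numFieldNormedType.Exports.

Local Open Scope classical_set_scope.
Local Open Scope ring_scope.

(* [scalar_field K re]: K is the field of real or complex numbers and re is its
   real-part map.  A complex normed module has its norm in R[i]; the norm is
   moved to R by re, so that suprema can be taken there. *)
Inductive scalar_field (R : realType) :
    forall K : numFieldType, (K -> R) -> Prop :=
| real_scalars : @scalar_field R R id
| complex_scalars : @scalar_field R R[i] (@complex.Re R).

Definition unit_ball (K : numFieldType) (X : normedModType K) : set X :=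
  [set x | `|x| <= 1].

Section OperatorNorm.
Variables (R : realType) (K : numFieldType) (re : K -> R).
Variable X : normedModType K.
Implicit Type T : X -> X.

(* Meaningful for bounded T: otherwise [sup] has the junk value 0. *)
Definition opnorm T : R := sup [set re `|T x| | x in @unit_ball K X].

Definition daugavet_equation T : Prop :=
  opnorm (fun x => x + T x) = 1 + opnorm T.

Definition rank_one T : Prop :=
  exists2 v : X, v != 0 & range T = [set k *: v | k in [set: K]].

Definition daugavet_property : Prop :=
  forall L : {linear X -> X},
    continuous L -> rank_one L -> daugavet_equation L.

End OperatorNorm.

Section SlicelyCountablyDetermined.
Variables (R : realType) (K : numFieldType) (re : K -> R).
Variable X : normedModType K.
Implicit Types (A B S H : set X) (V : nat -> set X) (a : X).

Definition open_half_space H : Prop :=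
  exists (f : {linear X -> K^o}) (c : R),
    [/\ continuous f, exists x, f x != 0 & H = [set x | c < re (f x)]].

Definition slice A S : Prop :=
  exists H, [/\ open_half_space H, S = A `&` H & S !=set0].

Definition closed_convex_hull B : set X :=
  closure (smallest (@convex_set K X) B).

Definition determining A V a : Prop :=
  forall B, B `<=` A -> (forall n, B `&` V n !=set0) ->
    closed_convex_hull B a.

Definition SCD A : set X :=
  [set a | A a /\
     exists V, (forall n, slice A (V n)) /\ determining A V a].

End SlicelyCountablyDetermined.

(* Main.v *)
Require Import Defs.
From HB Require Import structures.
From mathcomp Require Import all_boot all_order all_algebra.
From mathcomp Require Import all_classical all_reals.
From mathcomp Require Import topology normedtype convex.
From mathcomp Require Import interval_inference lra.
From mathcomp.real_closed Require Import complex.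

Set Implicit Arguments.
Unset Strict Implicit.
Unset Printing Implicit Defensive.

Import Order.TTheory GRing.Theory Num.Theory.
Import numFieldNormedType.Exports.

Local Open Scope classical_set_scope.
Local Open Scope ring_scope.

(** In a space with the Daugavet property, every slice of the unit ball
    contains, for each vector [w], a point [y] whose norm adds up almost
    perfectly with that of [w], that is, [|w + y|] is close to [|w| + 1]
    ([ball_slice_far]).  This is the Daugavet equation of the rank-one operator
    built from the functional of the slice and from [w].

    Let [a = T x] be an SCD point of [T (B_X)] with almost maximal norm, and let
    [V n] be slices determining for [a].  They pull back to slices of the ball,
    from which points [y n] can be chosen one after the other, each far from
    the partial sum before it.  If the errors are summable then
    [|a + y_0 + ... + y_(n-1)| >= |a| + n - e] for all [n]
    ([almost_additive_sequence]).  A convex combination [z] of the first [n]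
    points satisfies [|y_0 + ... + y_(n-1) - z| <= n - 1], so by the triangle
    inequality [|a + z| >= |a| + 1 - e] ([convex_far_set]).

    The points [T (y n)] meet all the [V n], so some convex combination [T z] of
    them is close to [a].  Hence [|z + T z|] is at least about [|a + z|], which
    is almost [|T| + 1].

    Norms take their values in the scalar field; all estimates are carried out
    on their real parts, written [rnorm], so that both scalar fields are treated
    at once. *)

Section DaugavetEquation.
Variables (R : realType) (K : numFieldType) (re : K -> R).
Hypothesis hK : scalar_field re.

(** * Real parts and real-valued norms *)

Lemma reD a b : re (a + b) = re a + re b.
Proof. by case: hK a b => // -[? ?] [? ?]. Qed.

Lemma re_norm_le a : re a <= re `|a|.
Proof.
case: hK a => [a|a]; first exact: ler_norm.
have := normc_ge_Re a; rewrite lecE => /andP[_ /=]; apply: le_trans.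
exact: ler_norm.
Qed.

(** Nonnegative scalars are real, so multiplication by them commutes with taking
    real parts. *)
Lemma re_pos_mul a b : 0 <= a -> re (a * b) = re a * re b.
Proof.
case: hK a b => //= -[ar ai] [br bi].
by rewrite lecE /= => /andP[/eqP -> _]; rewrite mul0r subr0.
Qed.

Lemma re0 : re 0 = 0.
Proof. by apply: (addrI (re 0)); rewrite -reD !addr0. Qed.

Lemma re_le a b : 0 <= a -> 0 <= b -> (re a <= re b) = (a <= b).
Proof.
case: hK a b => //= -[ar ai] [br bi].
by rewrite !lecE /= => /andP[/eqP -> _] /andP[/eqP -> _]; rewrite eqxx.
Qed.

Lemma re_lt a b : 0 <= a -> 0 <= b -> (re a < re b) = (a < b).
Proof.
by move=> a0 b0; rewrite lt_leAnge !re_le// -lt_leAnge.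
Qed.

Lemma re_surj r : 0 <= r -> exists2 a : K, 0 <= a & re a = r.
Proof.
by case: hK r => r r0; [exists r | exists (r%:C)%C => //; rewrite ler0c].
Qed.

Lemma re1 : re 1 = 1.
Proof. by case: hK. Qed.

Lemma re_ge0 a : 0 <= a -> 0 <= re a.
Proof. by move=> a0; rewrite -re0 re_le. Qed.

Lemma unimodular_rotation (k : K) : exists2 t : K, `|t| = 1 & t * k = `|k|.
Proof.
have [->|k0] := eqVneq k 0; first by exists 1; rewrite ?normr1 ?mulr0 ?normr0.
exists (`|k| / k); last by rewrite divfK.
by rewrite normf_div normr_id divff// normr_eq0.
Qed.

Section RealNorm.
Variable V : normedModType K.
Implicit Types x y : V.

Definition rnorm x : R := re `|x|.

Lemma rnorm0 : rnorm 0 = 0.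
Proof. by rewrite /rnorm normr0 re0. Qed.

Lemma rnorm_ge0 x : 0 <= rnorm x.
Proof. exact/re_ge0. Qed.

Lemma rnorm_le_add x y : rnorm (x + y) <= rnorm x + rnorm y.
Proof. by rewrite /rnorm -reD re_le ?addr_ge0// ler_normD. Qed.

Lemma rnorm_le_sum (I : Type) (r : seq I) (P : pred I) (F : I -> V) :
  rnorm (\sum_(i <- r | P i) F i) <= \sum_(i <- r | P i) rnorm (F i).
Proof.
elim/big_ind2: _ => //; first by rewrite rnorm0.
by move=> s a t b sa tb; apply: le_trans (rnorm_le_add a b) (lerD sa tb).
Qed.

Lemma rnormN x : rnorm (- x) = rnorm x.
Proof. by rewrite /rnorm normrN. Qed.

Lemma rnormZ k x : rnorm (k *: x) = re `|k| * rnorm x.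
Proof. by rewrite /rnorm normrZ re_pos_mul. Qed.

Lemma rnorm_gt0 x : x != 0 -> 0 < rnorm x.
Proof.
move=> x0; rewrite lt_neqAle rnorm_ge0 andbT eq_sym; apply: contra x0 => /eqP e.
have := re_le (normr_ge0 x) (lexx 0).
by rewrite re0 -/(rnorm x) e lexx => /esym; rewrite normr_le0.
Qed.

Lemma unit_ballE x : @unit_ball K V x = (rnorm x <= 1) :> Prop.
Proof. by rewrite /unit_ball /rnorm /= -re1 re_le. Qed.

Lemma exists_normalizer x : x != 0 -> exists2 k : K, 0 <= k & re k * rnorm x = 1.
Proof.
move=> /rnorm_gt0 x0; have [|k k0 kx] := @re_surj (rnorm x)^-1.
  by rewrite invr_ge0 ltW.
by exists k => //; rewrite kx mulVf// gt_eqF.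
Qed.

(** Balls of the topology have their radii in [K], whence the lift of [e]. *)
Lemma closure_rnorm (A : set V) (a : V) (e : R) :
  closure A a -> 0 < e -> exists2 b, A b & rnorm (a - b) < e.
Proof.
move=> clA e0; have [k k0 ke] := re_surj (ltW e0).
have kgt0 : 0 < k by rewrite -re_lt// re0 ke.
have [b [Ab]] := clA _ (nbhsx_ballx a k kgt0).
rewrite -ball_normE /= => abk; exists b => //.
by rewrite -ke re_lt.
Qed.

Lemma rnorm_convex_comb (c x y : V) (r : R) (l : K) : 0 <= l <= 1 ->
  rnorm (c - x) <= r -> rnorm (c - y) <= r ->
  rnorm (c - (l *: x + (1 - l) *: y)) <= r.
Proof.
move=> /andP[l0 l1] xr yr.
have -> : c - (l *: x + (1 - l) *: y) = l *: (c - x) + (1 - l) *: (c - y).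
  by rewrite !scalerBr addrACA -scalerDl -opprD [l + _]addrC subrK scale1r.
apply: le_trans (rnorm_le_add _ _) _.
have l1' : 0 <= 1 - l by rewrite subr_ge0.
rewrite !rnormZ !ger0_norm//.
have : re l + re (1 - l) = 1 by rewrite -reD addrC subrK re1.
have := re_ge0 l0; have := re_ge0 l1'.
by move=> ? ? ?; nra.
Qed.

End RealNorm.

(** * Suprema over the unit ball *)

Section SupNorm.
Variables V W : normedModType K.

(** For [W = V] this is [opnorm], and for [W = K] the norm of a functional. *)
Definition supnorm (g : V -> W) : R := sup [set rnorm (g x) | x in @unit_ball K V].

Lemma supnorm_le (g : V -> W) r :
  (forall x, rnorm x <= 1 -> rnorm (g x) <= r) -> supnorm g <= r.
Proof.
move=> gr; apply: ge_sup; last by move=> _ [x + <-]; rewrite unit_ballE => /gr.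
by exists (rnorm (g 0)), 0 => //; rewrite unit_ballE rnorm0.
Qed.

Lemma supnorm_gt (g : V -> W) r : r < supnorm g ->
  exists2 x, rnorm x <= 1 & r < rnorm (g x).
Proof.
move=> rg; apply: contrapT => no; move: rg; apply/negP; rewrite -leNgt.
apply: supnorm_le => x x1; rewrite leNgt; apply/negP => rx.
by apply: no; exists x.
Qed.

Lemma le_supnorm (g : V -> W) r x :
  (forall x, rnorm x <= 1 -> rnorm (g x) <= r) -> rnorm x <= 1 ->
  rnorm (g x) <= supnorm g.
Proof.
move=> gr x1; apply: ub_le_sup; last by exists x => //; rewrite unit_ballE.
by exists r => _ [z + <-]; rewrite unit_ballE => /gr.
Qed.

Lemma rnorm_le_supnorm (f : {linear V -> W}) x :
  continuous f -> rnorm x <= 1 -> rnorm (f x) <= supnorm f.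
Proof.
move=> f_cont.
have /linear_boundedP/pinfty_ex_gt0[M M0 fM] :
  bounded_near f (nbhs 0) by exact/linear_bounded_continuous.
apply: (@le_supnorm _ (re M)) => {}x; rewrite -unit_ballE /unit_ball /= => x1.
rewrite /rnorm re_le ?(ltW M0)//; apply: le_trans (fM x) _.
by rewrite ler_piMr// ltW.
Qed.

End SupNorm.

(** * Convex sets *)

Lemma convex_setI01 (V : normedModType K) (A : set V) :
  (forall x y (l : K), 0 <= l <= 1 -> A x -> A y -> A (l *: x + (1 - l) *: y)) ->
  @convex_set K V A.
Proof.
move=> Aconv x y l; rewrite !inE => Ax Ay; apply: Aconv => //.
by rewrite ge0 le1.
Qed.

(** * Rank-one operators *)

Section TensorOperator.
Variables (X : normedModType K) (f : {linear X -> K^o}) (v : X).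

Definition tensor : X -> X := fun x => f x *: v.

Let tensor_linear : linear tensor.
Proof. by move=> k x y; rewrite /tensor linearP /= scalerDl scalerA. Qed.

HB.instance Definition _ := GRing.isLinear.Build K X X _ tensor tensor_linear.

Lemma tensor_continuous : continuous f -> continuous tensor.
Proof. by move=> fc x; apply: cvgZl; exact: fc. Qed.

Lemma tensor_rank_one : (exists x, f x != 0) -> v != 0 -> rank_one tensor.
Proof.
move=> [x fx0] v0; exists v => //; apply/seteqP; split=> _ [k _ <-].
  by exists (f k).
by exists ((k / f x) *: x) => //; rewrite /tensor linearZ; congr (_ *: v); exact: divfK.
Qed.

Lemma supnorm_tensor : continuous f -> supnorm tensor = supnorm f * rnorm v.
Proof.
move=> fc.
apply/eqP; rewrite eq_le; apply/andP; split.
  apply: supnorm_le => x x1; rewrite rnormZ ler_wpM2r ?rnorm_ge0//.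
  exact: rnorm_le_supnorm.
have [->|v0] := eqVneq v 0.
  rewrite rnorm0 mulr0.
  have x1 : rnorm (0 : X) <= 1 by rewrite rnorm0.
  exact: le_trans (rnorm_ge0 _) (rnorm_le_supnorm (tensor_continuous fc) x1).
rewrite -ler_pdivlMr ?rnorm_gt0//; apply: supnorm_le => x x1.
rewrite ler_pdivlMr ?rnorm_gt0// -rnormZ.
exact: (rnorm_le_supnorm (tensor_continuous fc)).
Qed.

End TensorOperator.

(** * Slices of the ball in a Daugavet space *)

Section Daugavet.
Variable X : normedModType K.
Hypothesis X_nontrivial : exists x : X, x != 0.
Hypothesis X_daugavet : daugavet_property re X.

(** The functional may vanish here (the set is then empty or the whole ball): a
    slice of [T (B_X)] is cut out by a functional [f] that may be zero on the
    range of [T], and its pullback to the ball is cut out by [f \o T]. *)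
Definition ball_slice (f : {linear X -> K^o}) (c : R) : set X :=
  [set y | rnorm y <= 1 /\ c < re (f y)].

(** Normalize the rank-one operator [L = f (.) v], with [v] a multiple of [x], so
    that [|L| = |x|].  The Daugavet equation gives [u] in the ball with
    [|u + L u|] almost [1 + |x|].  This forces [|L u|] to be almost [|x|], hence
    [|f u|] to be almost [|f|].  Rotating [u] by a unimodular scalar makes [f u]
    positive: the rotated point lies in the slice and [L] sends it close to
    [x]. *)
Lemma ball_slice_far_nonzero (f : {linear X -> K^o}) (c : R) (x : X) (e : R) :
  continuous f -> ball_slice f c !=set0 -> x != 0 -> 0 < e ->
  exists2 y, ball_slice f c y & rnorm x + 1 - e < rnorm (x + y).
Proof.
move=> fc [y0 [y01 cy0]] x0 e0; have Nx0 := rnorm_gt0 x0.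
have [f0|/existsNP[z /eqP fz0]] := pselect (forall z, f z = 0).
  (* The set is the whole ball, and x / |x| adds up exactly with x. *)
  have [k k0 kx] := exists_normalizer x0.
  exists (k *: x); first split.
  - by rewrite rnormZ ger0_norm// kx.
  - by rewrite f0 -(f0 y0).
  rewrite -{2}[x]scale1r -scalerDl rnormZ ger0_norm ?addr_ge0// reD re1.
  lra.
set M := supnorm f.
have M0 : 0 < M.
  have z0 : z != 0 by apply: contra_neq fz0 => ->; rewrite linear0.
  have [k k0 kz] := exists_normalizer z0.
  have : rnorm (f (k *: z)) <= M.
    by apply: rnorm_le_supnorm => //; rewrite rnormZ ger0_norm// kz.
  rewrite linearZ rnormZ ger0_norm//; apply: lt_le_trans.
  rewrite mulr_gt0 ?rnorm_gt0//.
  have := re_ge0 k0; rewrite le_eqVlt => /orP[/eqP kz0|//].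
  by move: kz; rewrite -kz0 mul0r => /eqP; rewrite eq_sym oner_eq0.
have cM : c < M.
  apply: lt_le_trans cy0 (le_trans (re_norm_le _) _).
  exact: (rnorm_le_supnorm fc y01).
have [k k0 kM] : exists2 k : K, 0 <= k & re k = M^-1.
  by apply: re_surj; rewrite invr_ge0 ltW.
have NL : supnorm (tensor f (k *: x)) = rnorm x.
  by rewrite supnorm_tensor// rnormZ ger0_norm// kM mulrA mulfV ?mul1r// gt_eqF.
have kx0 : k *: x != 0.
  rewrite scaler_eq0 negb_or x0 andbT; apply/eqP => k00.
  by move: kM; rewrite k00 re0 => /esym/eqP; rewrite invr_eq0 gt_eqF.
have /= Deq := X_daugavet (tensor_continuous fc)
  (tensor_rank_one (ex_intro _ z fz0) kx0).
(* The rotated [u] will lie in the slice as soon as [|f u| / M > q]. *)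
pose q := Num.max 0 (c / M).
have q1 : q < 1.
  by rewrite /q gt_max ltr01 /= ltr_pdivrMr// mul1r.
pose d := Num.min (e / 2) ((1 - q) * rnorm x).
have d0 : 0 < d.
  by rewrite /d lt_min divr_gt0//= mulr_gt0// subr_gt0.
have [u u1 ud] : exists2 u, rnorm u <= 1 &
    1 + rnorm x - d < rnorm (u + tensor f (k *: x) u).
  apply: (@supnorm_gt _ _ (fun u => u + tensor f (k *: x) u)).
  by rewrite [ltRHS]Deq -NL; rewrite ltrBlDr ltrDl.
have [t t1 tu] := unimodular_rotation (f u).
set b := `|f u| in tu; have b0 : 0 <= b by exact: normr_ge0.
pose s := re b / M.
have s1 : s <= 1.
  by rewrite ler_pdivrMr// mul1r; exact: (rnorm_le_supnorm fc u1).
have reM : re (b * k) = s by rewrite re_pos_mul// kM.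
have bk1 : 0 <= 1 - b * k by rewrite subr_ge0 -re_le ?mulr_ge0// reM re1.
have NL_u : rnorm (tensor f (k *: x) u) = s * rnorm x.
  by rewrite /tensor !rnormZ (ger0_norm k0) kM mulrA.
have sd : rnorm x - d < s * rnorm x.
  by have := rnorm_le_add u (tensor f (k *: x) u); rewrite NL_u; lra.
have qs : q < s.
  have : d <= (1 - q) * rnorm x by rewrite /d ge_min lexx orbT.
  by rewrite -(ltr_pM2r Nx0); lra.
exists (t *: u).
  split; first by rewrite rnormZ t1 re1 mul1r.
  have -> : f (t *: u) = b by rewrite linearZ.
  rewrite -(ltr_pM2r (_ : 0 < M^-1)) ?invr_gt0//.
  by apply: le_lt_trans qs; rewrite /q le_max lexx orbT.
(* [b * k] is [|f u| / M], almost 1, so the last term is a small error. *)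
have rotate : x + t *: u =
    t *: (u + tensor f (k *: x) u) + (1 - b * k) *: x.
  by rewrite scalerDr /tensor !scalerA ?mulrA tu -addrA -scalerDl [b * k + _]addrC subrK
    scale1r addrC.
have := rnorm_le_add (x + t *: u) (- ((1 - b * k) *: x)).
rewrite {1}rotate addrK rnormZ t1 re1 mul1r rnormN rnormZ ger0_norm//.
have -> : re (1 - b * k) = 1 - s.
  by apply: (addIr (re (b * k))); rewrite -reD subrK re1 reM subrK.
have : d <= e / 2 by rewrite /d ge_min lexx.
lra.
Qed.

(** Points far from a nonzero vector have norm almost 1, which settles [x = 0]. *)
Lemma ball_slice_far (f : {linear X -> K^o}) (c : R) (x : X) (e : R) :
  continuous f -> ball_slice f c !=set0 -> 0 < e ->
  exists2 y, ball_slice f c y & rnorm x + 1 - e < rnorm (x + y).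
Proof.
move=> fc S0 e0; have [->|x0] := eqVneq x 0; last exact: ball_slice_far_nonzero.
have [z z0] := X_nontrivial.
have [y Sy zy] := ball_slice_far_nonzero fc S0 z0 e0.
exists y => //; rewrite add0r rnorm0; have := rnorm_le_add z y; lra.
Qed.

(** The points are chosen recursively, [y n] being far from [a] plus the sum of
    the earlier points with error [e / 2 ^ (n + 1)]; these errors sum up to less
    than [e]. *)
Lemma almost_additive_sequence (S : nat -> set X) (a : X) (e : R) : 0 < e ->
  (forall n x d, 0 < d -> exists2 y, S n y & rnorm x + 1 - d < rnorm (x + y)) ->
  exists y : nat -> X, (forall n, S n (y n)) /\
    forall n, rnorm a + n%:R - e <= rnorm (a + \sum_(k < n) y k).
Proof.
move=> e0 Sfar; pose d n : R := e * 2^-1 ^+ n.+1.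
have d0 n : 0 < d n by rewrite mulr_gt0// exprn_gt0// invr_gt0.
have /choice[F FP] : forall nw : nat * X, exists y,
    S nw.1 y /\ rnorm nw.2 + 1 - d nw.1 < rnorm (nw.2 + y).
  by move=> [n w]; have [y] := Sfar n w _ (d0 n); exists y.
pose w := fix w n := if n is m.+1 then w m + F (m, w m) else a.
exists (fun n => F (n, w n)); split=> [n|n]; first exact: (FP (n, w n)).1.
have -> : a + \sum_(k < n) F (nat_of_ord k, w k) = w n.
  elim: n => [|n IHn]; first by rewrite big_ord0 addr0.
  by rewrite big_ord_recr /= addrA IHn.
suff : rnorm a + n%:R - e * (1 - 2^-1 ^+ n) <= rnorm (w n).
  have : 0 < e * 2^-1 ^+ n by rewrite mulr_gt0// exprn_gt0// invr_gt0.
  lra.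
elim: n => [|n IHn]; first by rewrite expr0 subrr mulr0 subr0 addr0.
have /= := (FP (n, w n)).2; rewrite /d exprS -[n.+1%:R]natr1; lra.
Qed.

(** [G] consists of the points [z] of the ball with
    [|y_0 + ... + y_(n-1) - z| <= n - 1] for all large [n].  It is convex because
    it is an increasing union of intersections of balls, and it contains each
    [y n], since removing one term from a sum of [m] vectors of the ball leaves a
    vector of norm at most [m - 1].  Describing it
    by these inequalities replaces an explicit convex hull of the sequence. *)
Lemma convex_far_set (y : nat -> X) (a : X) (e : R) :
  (forall n, rnorm (y n) <= 1) ->
  (forall n, rnorm a + n%:R - e <= rnorm (a + \sum_(k < n) y k)) ->
  exists G : set X, [/\ forall n, G (y n),
    forall u v (l : K), 0 <= l <= 1 -> G u -> G v -> G (l *: u + (1 - l) *: v),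
    forall z, G z -> rnorm z <= 1 &
    forall z, G z -> rnorm a + 1 - e <= rnorm (a + z)].
Proof.
move=> y1 ya.
exists [set z | rnorm z <= 1 /\
  exists N, forall n, (N <= n)%N -> rnorm (\sum_(k < n) y k - z) <= n%:R - 1].
split=> [n|u v l l01 [u1 [N uN]] [v1 [M vM]]|z []//|z [z1 [N zN]]].
- split=> //; exists n.+1 => m nm.
  pose m' := Ordinal nm; rewrite (bigD1 m')//= [y n + _]addrC addrK.
  apply: le_trans (rnorm_le_sum _ _ _) _.
  apply: (@le_trans _ _ (\sum_(k < m | k != m') 1)); first exact: ler_sum.
  have : \sum_(k < m) 1 = m%:R :> R by rewrite sumr_const card_ord.
  by rewrite (bigD1 m')//= => <-; rewrite addrC addrK.
- split.
    have := @rnorm_convex_comb _ 0 u v 1 l l01.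
    by rewrite !sub0r !rnormN; apply.
  exists (maxn N M) => n; rewrite geq_max => /andP[Nn Mn].
  by apply: rnorm_convex_comb => //; [exact: uN|exact: vM].
- have := ya N; have := zN N (leqnn N).
  have := rnorm_le_add (a + z) (\sum_(k < N) y k - z).
  rewrite addrACA subrr addr0; lra.
Qed.

(** * Daugavet equation from SCD points *)

Lemma daugavet_equation_of_SCD_points (T : {linear X -> X}) :
  continuous T ->
  (forall eps : R, 0 < eps -> exists x : X,
    SCD re (T @` @unit_ball K X) (T x) /\ opnorm re T - eps < re `|T x|) ->
  daugavet_equation re T.
Proof.
move=> Tc hSCD.
have T_ub z : rnorm z <= 1 -> rnorm (T z) <= supnorm T.
  exact: rnorm_le_supnorm.
have idT_ub z : rnorm z <= 1 -> rnorm (z + T z) <= 1 + supnorm T.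
  by move=> z1; apply: le_trans (rnorm_le_add _ _) (lerD z1 (T_ub z z1)).
apply/eqP; rewrite eq_le; apply/andP; split; first exact: supnorm_le.
apply/ler_addgt0Pr => e e0; have d0 : 0 < e / 3 by rewrite divr_gt0.
have [x [[_ [V [V_slice V_det]]] Tx]] := hSCD _ d0.
have far n w d : 0 < d -> exists2 y, (rnorm y <= 1 /\ V n (T y)) &
    rnorm w + 1 - d < rnorm (w + y).
  move=> d_gt0; have [H [[f [c [fc _ ->]]] VE V0]] := V_slice n.
  pose g : {linear X -> K^o} := f \o T.
  have gc : continuous g by move=> z; apply: continuous_comp; [exact: Tc|exact: fc].
  have g_slice : ball_slice g c !=set0.
    have [p] := V0; rewrite VE => -[[z + <-] cz].
    by rewrite unit_ballE => z1; exists z.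
  have [y [y1 cy] wy] := ball_slice_far w gc g_slice d_gt0.
  exists y => //; split=> //; rewrite VE; split=> //.
  by exists y => //; rewrite unit_ballE.
have [y [yV ya]] := almost_additive_sequence (T x) d0 far.
have [G [Gy Gconv G1 Ga]] := convex_far_set (fun n => (yV n).1) ya.
have hull : closed_convex_hull (range (T \o y)) (T x).
  apply: V_det => [_ [n _ <-]|n].
    by exists (y n) => //; rewrite unit_ballE; exact: (yV n).1.
  by exists (T (y n)); split; [exists n|exact: (yV n).2].
have [b Bb Txb] := closure_rnorm hull d0.
have [z Gz Tzb] : (T @` G) b.
  apply: (Bb (T @` G)); split; last by move=> _ [n _ <-]; exists (y n).
  apply: convex_setI01 => _ _ l l01 [u Gu <-] [v Gv <-].
  exists (l *: u + (1 - l) *: v); first exact: Gconv.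
  by rewrite linearD !linearZ.
have lower := Ga z Gz.
have upper := le_supnorm idT_ub (G1 z Gz).
have triangle := rnorm_le_add (z + T z) (T x - T z).
have {}Txb : rnorm (T x - T z) < e / 3 by rewrite Tzb.
rewrite addrACA [z + T x]addrC subrr addr0 in triangle.
have {}Tx : supnorm T - e / 3 < rnorm (T x) by exact: Tx.
have : 1 + supnorm T <= supnorm (fun u => u + T u) + e by lra.
by [].
Qed.

End Daugavet.

End DaugavetEquation.

Theorem theorem6p5 (R : realType) (K : numFieldType) (re : K -> R)
  (hK : scalar_field re)
  (X : completeNormedModType K) (hX : exists x : X, x != 0)
  (hD : daugavet_property re X)
  (T : {linear X -> X}) (hT : continuous T)
  (hSCD : forall eps : R, 0 < eps ->
    exists x : X, SCD re (T @` @unit_ball K X) (T x) /\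
      opnorm re T - eps < re `|T x|) :
  daugavet_equation re T.
Proof. exact: daugavet_equation_of_SCD_points. Qed.
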